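(* Let $p,q$ be primes with $q\mid p-1$, let $\ell>1$ be a divisor of $p-1$ with $q\nmid\ell$, and let $i,i'$ be integers each lying in $\{1,\dots,(q-1)/2\}$ if $q$ is odd, and equal to $1$ if $q=2$. Then $\Gamma(pq,\ell,i)\cong\Gamma(pq,\ell,i')$ if and only if $i=i'$.
   Context: For a group $G$ and an inverse-closed subset $S\subseteq G\setminus\{1\}$, $\mathrm{Cay}(G,S)$ is the graph with vertex set $G$ and edges $\{x,y\}$ with $yx^{-1}\in S$. For $H\leqslant\mathrm{Aut}(G)$ and $g\in G\setminus\{1\}$, $\Gamma(G,H,g):=\mathrm{Cay}(G,g^H\cup g^{-H})$, where $g^H$ is the $H$-orbit of $g$ and $g^{-H}=(g^{-1})^H$. Let $A=\mathrm{AGL}(1,p)$ be the group of maps $x\mapsto xa+b$ of $\mathbb{Z}_p$ ($a\ne0$), with maps composed left to right. Let $m$ be a fixed primitive element of $\mathbb{Z}_p$, write $m$ also for the map $x\mapsto xm$, and let $t:x\mapsto x+1$, so $m^{-1}tm=t^m$. Put $z=m^{(p-1)/q}$, $G_{pq}=\langle z,t\rangle\leqslant A$. Subgroups of $A$ act on $G_{pq}$ by conjugation. For a divisor $\ell>1$ of $p-1$, $H_{(\ell,1)}=\langle m^{(p-1)/\ell}t\rangle$ and $\Gamma(pq,\ell,i):=\Gamma(G_{pq},H_{(\ell,1)},z^i)$. *)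

(* Defs.v *)
From mathcomp Require Import all_boot all_order all_fingroup all_algebra all_solvable.

Set Implicit Arguments.
Unset Strict Implicit.
Unset Printing Implicit Defensive.

Import GroupScope.

Record graph := Graph { vertex : finType; adj : rel vertex }.

Definition simple_graph (X : graph) : Prop :=
  symmetric (@adj X) /\ irreflexive (@adj X).

Definition graph_iso (X Y : graph) : Prop :=
  exists2 f : vertex X -> vertex Y,
    bijective f & forall x y, adj (f x) (f y) = adj x y.

(* No condition is put on S here: Cay_simple shows that this is a simple graph
   when S is an inverse-closed subset of G minus 1. *)
Definition Cay (gT : finGroupType) (G : {group gT}) (S : {set gT}) : graph :=
  @Graph [the finType of subg_of G]
         (fun x y => sgval y * (sgval x)^-1 \in S).

(* H is meant to be a subgroup of Aut G, and g a nontrivial element of G;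
   'P is the natural action of permutations. *)
Definition Gamma (gT : finGroupType) (G : {group gT}) (H : {set {perm gT}})
    (g : gT) : graph :=
  Cay G (orbit 'P H g :|: orbit 'P H g^-1).

Section Affine.

Variable p : nat.

Lemma affine_inj (a : {unit 'F_p}) (b : 'F_p) :
  injective (fun x : 'F_p => (x * val a + b)%R).
Proof.
by move=> x y /GRing.addIr; apply: GRing.mulIr; apply: (valP a).
Qed.

(* The product of permutations is composition from left to right. *)
Definition affine (a : {unit 'F_p}) (b : 'F_p) : {perm 'F_p} :=
  perm (@affine_inj a b).

Definition AGL1 : {set {perm 'F_p}} :=
  [set affine u.1 u.2 | u in [set: {unit 'F_p} * 'F_p]].

Definition mulmap (m : {unit 'F_p}) : {perm 'F_p} := affine m 0%R.

Definition transl : {perm 'F_p} := affine 1 1%R.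

Definition zmap (m : {unit 'F_p}) (q : nat) : {perm 'F_p} :=
  mulmap m ^+ (p.-1 %/ q).

Definition Gpq (m : {unit 'F_p}) (q : nat) : {group {perm 'F_p}} :=
  <<[set zmap m q; transl]>>%G.

Definition Hl1 (m : {unit 'F_p}) (l : nat) : {group {perm 'F_p}} :=
  <[mulmap m ^+ (p.-1 %/ l) * transl]>%G.

(* conj_aut G maps an element of 'N(G) to the automorphism of G that it induces
   by conjugation; Hl1_norm shows that Hl1 m l lies in 'N(Gpq m q). *)
Definition Gamma_pq (m : {unit 'F_p}) (q l i : nat) : graph :=
  Gamma (Gpq m q) (conj_aut (Gpq m q) @* Hl1 m l) (zmap m q ^+ i).

End Affine.

Definition index_range (q i : nat) : bool :=
  if q == 2 then i == 1%N else (1 <= i <= (q - 1) %/ 2)%N.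

Lemma Cay_simple (gT : finGroupType) (G : {group gT}) (S : {set gT}) :
  S \subset G^# -> S^-1 = S -> simple_graph (Cay G S).
Proof.
move=> sSG SV; split=> [x y | x] /=.
  by rewrite -[in LHS]SV inE invMg invgK.
rewrite mulgV; apply/negP => /(subsetP sSG).
by rewrite !inE eqxx.
Qed.

Lemma Gamma_simple (gT : finGroupType) (G : {group gT})
    (H : {group {perm gT}}) (g : gT) :
  H \subset Aut G -> g \in G^# -> simple_graph (Gamma G H g).
Proof.
move=> sHA /setD1P[g1 Gg].
have autM (h : {perm gT}) : h \in H -> {in G &, {morph h : x y / x * y}}.
  by move=> Hh; have /(subsetP sHA) := Hh; rewrite inE => /andP[_ /morphicP].
have autG (h : {perm gT}) x : h \in H -> x \in G -> h x \in G.
  by move=> /(subsetP sHA) Ah Gx; rewrite (Aut_closed Ah).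
have aut1 (h : {perm gT}) : h \in H -> h 1 = 1.
  move=> Hh; apply: (mulgI (h 1)).
  by rewrite -(autM h Hh) ?group1 // !mulg1.
have autV (h : {perm gT}) x : h \in H -> x \in G -> h x^-1 = (h x)^-1.
  move=> Hh Gx; apply/eqP; rewrite eq_sym eq_invg_mul -autM ?groupV //.
  by rewrite mulgV aut1.
have orbV x : x \in G -> (orbit 'P H x)^-1 = orbit 'P H x^-1.
  move=> Gx; apply/setP => y; rewrite inE.
  apply/imsetP/imsetP => [[h Hh yE]|[h Hh yE]]; exists h => //=.
    by rewrite /aperm autV //; rewrite /= /aperm in yE; rewrite -yE invgK.
  by rewrite yE /= /aperm autV // invgK.
have orbG x : x \in G -> x != 1 -> orbit 'P H x \subset G^#.
  move=> Gx x1; apply/subsetP => _ /imsetP[h Hh ->] /=; rewrite !inE /aperm.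
  by rewrite autG // andbT -(aut1 h Hh) (inj_eq perm_inj).
apply: Cay_simple.
  by rewrite subUset !orbG ?groupV // eq_invg1.
rewrite invUg !orbV ?groupV // invgK.
by rewrite setUC.
Qed.

Section AffineFacts.

Variable p : nat.
Implicit Types (a c m : {unit 'F_p}) (b d : 'F_p) (q l i : nat).

Lemma affineM a b c d :
  affine a b * affine c d = affine (a * c) (b * val c + d)%R.
Proof.
by apply/permP => x; rewrite permM !permE /= GRing.mulrDl GRing.mulrA GRing.addrA.
Qed.

Lemma affine1 : affine (1 : {unit 'F_p}) 0%R = 1.
Proof. by apply/permP => x; rewrite permE perm1 FinRing.val_unit1 GRing.mulr1 GRing.addr0. Qed.

Lemma AGL1_group_set : group_set (AGL1 p).
Proof.
apply/group_setP; split=> [|_ _ /imsetP[[a b] _ ->] /imsetP[[c d] _ ->]] /=.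
  by apply/imsetP; exists (1, 0%R); rewrite ?inE //= affine1.
apply/imsetP; exists (a * c, (b * val c + d)%R); first by rewrite inE.
by rewrite affineM.
Qed.

Canonical AGL1_group := Group AGL1_group_set.

Lemma affine_AGL1 a b : affine a b \in AGL1 p.
Proof. by apply/imsetP; exists (a, b). Qed.

Lemma mulmapX m i : mulmap m ^+ i = mulmap (m ^+ i).
Proof.
elim: i => [|i IH]; first by rewrite !expg0 /mulmap affine1.
by rewrite !expgS IH /mulmap affineM GRing.mul0r GRing.addr0.
Qed.

Lemma translX i : transl p ^+ i = affine 1 (i%:R)%R.
Proof.
elim: i => [|i IH]; first by rewrite expg0 affine1.
by rewrite expgSr IH /transl affineM mulg1 FinRing.val_unit1 GRing.mulr1 GRing.mulrSr.
Qed.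

Lemma translE b : affine 1 b = transl p ^+ b.
Proof. by rewrite translX; congr affine; rewrite natr_Zp. Qed.

Lemma transl_conj m : transl p ^ mulmap m = transl p ^+ val m.
Proof.
apply: (mulgI (mulmap m)); rewrite -conjgC -translE /transl /mulmap !affineM ?FinRing.val_unit1.
by rewrite mul1g mulg1 !GRing.mul1r !GRing.mul0r GRing.addr0 GRing.add0r.
Qed.

Lemma Gpq_AGL1 m q : Gpq m q \subset AGL1 p.
Proof.
rewrite gen_subG; apply/subsetP => x /set2P[] ->; last exact: affine_AGL1.
by rewrite /zmap mulmapX affine_AGL1.
Qed.

Lemma AGL1_norm m q : AGL1 p \subset 'N(Gpq m q).
Proof.
have Gt b : affine 1 b \in Gpq m q.
  by rewrite translE groupX // mem_gen // set22.
apply/subsetP => _ /imsetP[[a b] _ ->] /=; rewrite inE -genJ gen_subG.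
apply/subsetP => _ /imsetP[x /set2P[] -> ->].
  set z := zmap m q; have Gz : z \in Gpq m q by rewrite mem_gen // set21.
  have zE : z = affine (m ^+ (p.-1 %/ q)) 0%R by rewrite /z /zmap mulmapX.
  suff [d ->] : exists d, z ^ affine a b = z * affine 1 d by rewrite groupM.
  exists (b - b * val (m ^+ (p.-1 %/ q))%g)%R.
  apply: (mulgI (affine a b)); rewrite -conjgC zE !affineM mulg1.
  have -> : (a * m ^+ (p.-1 %/ q) = m ^+ (p.-1 %/ q) * a)%g.
    by apply: val_inj; rewrite !FinRing.val_unitM GRing.mulrC.
  congr affine; rewrite FinRing.val_unit1 !GRing.mul0r !GRing.add0r.
  by rewrite [RHS]GRing.addrC GRing.subrK.
suff [d ->] : exists d, transl p ^ affine a b = affine 1 d by [].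
exists (val a); apply: (mulgI (affine a b)).
rewrite -conjgC /transl !affineM mul1g mulg1 ?FinRing.val_unit1 GRing.mul1r GRing.mulr1.
by rewrite GRing.addrC.
Qed.

Lemma Hl1_norm m q l : Hl1 m l \subset 'N(Gpq m q).
Proof.
apply: subset_trans (AGL1_norm m q); rewrite cycle_subG mulmapX.
by rewrite groupM ?affine_AGL1.
Qed.

Lemma Gamma_pq_simple m q l i :
  prime p -> prime q -> q %| p.-1 -> generator [set: {unit 'F_p}] m ->
  0 < i < q -> simple_graph (Gamma_pq m q l i).
Proof.
move=> p_pr q_pr q_dv /eqP m_gen /andP[i_gt0 i_lt].
apply: Gamma_simple; first exact: Aut_conj_aut.
rewrite 2!inE groupX ?mem_gen ?set21 // andbT.
have om : #[m] = p.-1.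
  have := card_units_Zp (pdiv_gt0 p).
  by rewrite [in totient _]pdiv_id // totient_prime // {1}/units_Zp m_gen.
have p1_gt0 : 0 < p.-1 by rewrite -subn1 subn_gt0 prime_gt1.
rewrite /zmap mulmapX mulmapX -expgM; apply/negP => /eqP/permP/(_ 1%R).
rewrite permE perm1 /= GRing.mul1r GRing.addr0 => w1.
have /eqP : m ^+ (p.-1 %/ q * i) = 1 by apply: val_inj.
rewrite -order_dvdn om -{1}(divnK q_dv) dvdn_pmul2l ?divn_gt0 ?prime_gt0 //.
  by rewrite gtnNdvd.
by rewrite dvdn_leq.
Qed.

End AffineFacts.

(* Main.v *)
(* Let K and L be the subgroups of order q and l of the units of F_p. The
   element x |-> x w + 1 generating H_(l,1) has a fixed point; moving it to 0 and
   rescaling identifies Gamma(pq,l,i) with the layered graph on K x F_p in which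
   (u, x) is joined to (z^i u, x + h u) for h in L.  The translations
   (u, x) |-> (u, x + c) form a Sylow p-subgroup of the automorphism group of
   that graph: their orbits are also the orbits of any p-group of automorphisms
   containing them, and an automorphism that normalises them and has p-power
   order moves all layers by the same translation.  By Sylow's theorem
   isomorphic layered graphs thus have an isomorphism f normalising the
   translations, that is, f permutes the layers and has the same slope a on each
   of them.  The layers of u = 1, z^i, z^(2i) are then carried to successive
   layers, with step s = z^i' or s = z^(-i'), and comparing the edges between
   them gives z^i L = s L, hence z^i = s since K and L meet trivially. *)
Require Import Defs.
From mathcomp Require Import all_boot all_order all_fingroup all_algebra all_solvable all_field.
From mathcomp Require Import ring.

Set Implicit Arguments.
Unset Strict Implicit.
Unset Printing Implicit Defensive.

Import GroupScope GRing.Theory.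

(** * Blocks and adjacency of the layered graphs *)

Section Layered.

Variables (p : nat) (K L : {group {unit 'F_p}}).
Hypothesis p_pr : prime p.
Hypothesis ntL : L :!=: 1.

Local Notation V := (subg_of K * 'F_p)%type.

Definition block (u : {unit 'F_p}) : {set 'F_p} := val @: (L :* u).

Definition layered_adj (s : subg_of K) : rel V := fun v w =>
  (w.1 == s * v.1) && (w.2 - v.2 \in block (sgval v.1))%R ||
  (v.1 == s * w.1) && (v.2 - w.2 \in block (sgval w.1))%R.

Lemma card_units_Fp : #|[set: {unit 'F_p}]| = p.-1.
Proof. by rewrite card_finField_unit card_Fp. Qed.

(** The order of [H] lies between 1 and p - 1, so p does not divide it. *)
Lemma natr_card_unit_subgroup (H : {group {unit 'F_p}}) : (#|H|%:R != 0 :> 'F_p)%R.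
Proof.
have p_gt1 := prime_gt1 p_pr.
have Hp : (#|H| <= p.-1)%N by rewrite -card_units_Fp subset_leq_card ?subsetT.
rewrite -(dvdn_pcharf (pchar_Fp p_pr)) gtnNdvd ?cardG_gt0 //.
by rewrite (leq_ltn_trans Hp) // ltn_predL prime_gt0.
Qed.

Lemma mem_block (x : {unit 'F_p}) u : (val x \in block u) = (x \in L :* u).
Proof. by rewrite mem_imset //; apply: val_inj. Qed.

Lemma card_block u : #|block u| = #|L|.
Proof. by rewrite card_imset ?card_rcoset //; apply: val_inj. Qed.

(** Multiplication by a nontrivial h in [L] permutes the block, so its sum S satisfies h S = S. *)
Lemma sum_block u : (\sum_(x in block u) x = 0)%R.
Proof.
have [h Lh nt_h] := trivgPn _ ntL.
set S := (\sum_(x in _) x)%R.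
have hS : (val h * S = S)%R.
  rewrite {1}/S big_distrr /= [RHS](reindex_inj (mulrI (valP h))) /=.
  have hL y : (h * y \in L :* u) = (y \in L :* u).
    by rewrite !mem_rcoset -mulgA groupMl.
  apply: eq_bigl => x; apply/imsetP/imsetP => -[y Ly].
    by move=> ->; exists (h * y); rewrite ?hL.
  move=> hx; exists (h^-1 * y); first by rewrite -hL mulKVg.
  by apply: (mulrI (valP h)); rewrite hx -FinRing.val_unitM mulKVg.
have : (S * (val h - 1) = 0)%R by rewrite mulrBr mulr1 mulrC hS subrr.
move/eqP; rewrite mulf_eq0 subr_eq0 => /orP[/eqP // | /eqP h1].
by case/eqP: nt_h; apply: val_inj; rewrite h1.
Qed.

(* Comparing the sums of both blocks, which vanish, gives #|L| c = 0. *)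
Lemma block_affine (a c : 'F_p) u v : (a != 0)%R ->
  (forall y, (a * y + c \in block v) = (y \in block u))%R -> c = 0%R.
Proof.
move=> nz_a auv.
have inj_ac : injective (fun y => a * y + c)%R.
  by move=> x y /addIr; apply: mulfI.
have := sum_block v; rewrite (reindex_inj inj_ac) /= (eq_bigl _ _ auv).
rewrite big_split /= -mulr_sumr sum_block mulr0 add0r sumr_const card_block.
rewrite -mulr_natr => /eqP; rewrite mulf_eq0 (negPf (natr_card_unit_subgroup L)) orbF.
by move/eqP.
Qed.

Lemma layered_adj_sym s : symmetric (layered_adj s).
Proof. by move=> v w; rewrite /layered_adj orbC. Qed.

(** The reverse disjunct would need u = s (s u), which [s ^+ 2 != 1] excludes. *)
Lemma layered_adj_step s u x y : s ^+ 2 != 1 ->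
  layered_adj s (u, x) (s * u, y) = (y - x \in block (sgval u))%R.
Proof.
move=> s2; rewrite /layered_adj /= eqxx /= mulgA -expg2.
by rewrite -{2}[u]mul1g (inj_eq (mulIg u)) eq_sym (negPf s2) orbF.
Qed.

(** * The group of translations and its normaliser *)

Lemma shift_inj (c : 'F_p) : injective (fun v : V => (v.1, v.2 + c)%R).
Proof.
move=> [u x] [v y] e; congr pair; first exact: (congr1 fst e).
exact: addIr (congr1 snd e).
Qed.

Definition shift c : {perm V} := perm (@shift_inj c).

Lemma shiftE c v : shift c v = (v.1, v.2 + c)%R.
Proof. by rewrite permE. Qed.

Lemma shiftX c n : shift c ^+ n = shift (c *+ n)%R.
Proof.
elim: n => [|n IHn]; first by apply/permP=> -[u x]; rewrite expg0 perm1 shiftE /= addr0.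
by apply/permP=> v; rewrite expgSr permM IHn !shiftE /= mulrSr addrA.
Qed.

Lemma shift_gen c : shift c = shift 1%R ^+ c.
Proof. by rewrite shiftX natr_Zp. Qed.

Definition shifts : {group {perm V}} := <[shift 1%R]>.

Lemma mem_shifts c : shift c \in shifts.
Proof. by rewrite shift_gen mem_cycle. Qed.

Lemma shiftsP g : reflect (exists c, g = shift c) (g \in shifts).
Proof.
apply: (iffP (@cycleP _ (shift 1%R) g)) => [[n ->]|[c ->]].
  by exists (n%:R)%R; rewrite shiftX.
by exists c; rewrite shift_gen.
Qed.

Lemma card_shifts : #|shifts| = p.
Proof.
have inj : injective shift.
  by move=> c d /permP/(_ (1, 0%R)); rewrite !shiftE /= !add0r => /(congr1 snd).
rewrite -[RHS](card_Fp p_pr) -cardsT -(card_imset _ inj); apply: eq_card => g.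
by apply/shiftsP/imsetP => [[c ->]|[c _ ->]]; exists c.
Qed.

Lemma norm_shifts (f : {perm V}) : f \in 'N(shifts) ->
  exists a, forall c, shift c ^ f = shift (a * c)%R.
Proof.
move=> nf; have : shift 1%R ^ f \in shifts by rewrite memJ_norm ?mem_shifts.
case/shiftsP => a fa; exists a => c.
by rewrite shift_gen conjXg fa shiftX -[in RHS](natr_Zp c) mulr_natr.
Qed.

Lemma norm_shiftsE (f : {perm V}) a : (forall c, shift c ^ f = shift (a * c)%R) ->
  forall u x, f (u, x) = ((f (u, 0%R)).1, a * x + (f (u, 0%R)).2)%R.
Proof.
move=> fa u x; have -> : (u, x) = shift x (u, 0%R) by rewrite shiftE /= add0r.
by rewrite -permM conjgC fa permM shiftE addrC.
Qed.

Lemma norm_shifts_neq0 (f : {perm V}) a :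
  (forall c, shift c ^ f = shift (a * c)%R) -> (a != 0)%R.
Proof.
move=> fa; apply/eqP=> a0.
have := norm_shiftsE fa 1%g 1%R; rewrite a0 mul0r add0r -surjective_pairing.
by move/perm_inj/(congr1 snd)/eqP; rewrite oner_eq0.
Qed.

(** A nonzero slope makes f map each layer onto a whole layer, so two layers with the same image
    layer would share a value of f. *)
Lemma norm_shifts_layer (f : {perm V}) a :
  (forall c, shift c ^ f = shift (a * c)%R) ->
  forall u v, (f (u, 0%R)).1 = (f (v, 0%R)).1 -> u = v.
Proof.
move=> fa u v e; have nz_a := norm_shifts_neq0 fa.
have : f (u, ((f (v, 0)).2 - (f (u, 0)).2) / a)%R = f (v, 0%R).
  rewrite (norm_shiftsE fa) mulrC divfK // subrK e.
  by rewrite -surjective_pairing.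
by move/perm_inj/(congr1 fst).
Qed.

(** * Isomorphisms and automorphisms of layered graphs *)

Definition layered_iso (s s' : subg_of K) (f : {perm V}) :=
  [forall v, forall w, layered_adj s' (f v) (f w) == layered_adj s v w].

Lemma layered_isoP s s' (f : {perm V}) :
  reflect (forall v w, layered_adj s' (f v) (f w) = layered_adj s v w)
          (layered_iso s s' f).
Proof.
apply: (iffP forallP) => [H v w | H v]; first by have /forallP/(_ w)/eqP := H v.
by apply/forallP=> w; apply/eqP.
Qed.

Lemma layered_aut_group_set s : group_set [set f | layered_iso s s f].
Proof.
apply/group_setP; split=> [|f g].
  by rewrite inE; apply/layered_isoP=> v w; rewrite !perm1.
rewrite !inE => /layered_isoP Hf /layered_isoP Hg.
by apply/layered_isoP=> v w; rewrite !permM Hg Hf.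
Qed.

Definition layered_aut s : {group {perm V}} := Group (layered_aut_group_set s).

Lemma shifts_layered_aut s : shifts \subset layered_aut s.
Proof.
rewrite cycle_subG inE; apply/layered_isoP => v w.
rewrite /layered_adj !shiftE /=.
have e (x y : 'F_p) : (x + 1 - (y + 1) = x - y)%R by ring.
by rewrite !e.
Qed.

Lemma orbit_shifts (v w : V) : v.1 = w.1 -> w \in orbit 'P shifts v.
Proof.
move=> e; apply/imsetP; exists (shift (w.2 - v.2)%R); first exact: mem_shifts.
by rewrite /= /aperm shiftE e addrC subrK -surjective_pairing.
Qed.

(* Orbit lengths are powers of p below |V| = |K| p < p^2, so the orbits of P
   are those of the translations. *)
Lemma pgroup_layer (P : {group {perm V}}) : p.-group P -> shifts \subset P ->
  forall g v, g \in P -> (g v).1 = v.1.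
Proof.
move=> pP sTP g v Pg.
have sub : [set w : V | w.1 == v.1] \subset orbit 'P P v.
  apply/subsetP=> w; rewrite inE => /eqP e.
  have /imsetP[t Tt ->] := orbit_shifts (esym e).
  by apply/imsetP; exists t; rewrite ?(subsetP sTP).
have cardL : #|[set w : V | w.1 == v.1]| = p.
  rewrite -[RHS](card_Fp p_pr) -(card_imset (f := fun x => (v.1, x)) 'F_p);
    last by move=> x y /(congr1 snd).
  apply: eq_card => -[u x]; rewrite inE /=; apply/eqP/imsetP => [->|[y _ [-> _]] //].
  by exists x.
have cardV : #|orbit 'P P v| < p ^ 2.
  apply: leq_ltn_trans (max_card _) _; rewrite card_prod card_Fp // expnS expn1.
  rewrite ltn_pmul2r ?prime_gt0 // card_sub.
  rewrite (@leq_ltn_trans p.-1) ?ltn_predL ?prime_gt0 //.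
  by rewrite -card_units_Fp subset_leq_card ?subsetT.
have /p_natP[k ok] : p.-nat #|orbit 'P P v|.
  exact: pnat_dvd (dvdn_orbit _ _ _) pP.
have k1 : (k <= 1)%N.
  by move: cardV; rewrite ok ltn_exp2l ?prime_gt1.
have /eqP e : [set w : V | w.1 == v.1] == orbit 'P P v.
  rewrite eqEcard sub cardL ok -[X in (_ <= X)%N]expn1.
  by rewrite leq_pexp2l ?prime_gt0.
have : g v \in orbit 'P P v by apply/imsetP; exists g.
by rewrite -e inE => /eqP.
Qed.

(** * The translations as a Sylow p-subgroup *)

Section Generator.

Variables s : subg_of K.
Hypotheses (s_gen : <[s]> = [set: subg_of K]) (s2 : s ^+ 2 != 1).

(** Between the layers u and s u, g changes differences by c (s u) - c u. This constant preserves
    the block of u, hence is 0 by [block_affine]; as s generates, c is constant. *)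
Lemma layered_aut_shift g (c : subg_of K -> 'F_p) : g \in layered_aut s ->
  (forall u x, g (u, x) = (u, x + c u)%R) -> g \in shifts.
Proof.
rewrite inE => /layered_isoP ag gc.
have cs u : c (s * u) = c u.
  apply/eqP; rewrite -subr_eq0; apply/eqP.
  apply: (@block_affine 1%R _ (sgval u) (sgval u)); first by rewrite oner_eq0.
  move=> y; have := ag (u, 0%R) (s * u, y).
  rewrite !gc !layered_adj_step // subr0 => <-.
  by rewrite add0r mul1r addrA.
have c1 u : c u = c 1.
  have /cycleP[n ->] : u \in <[s]> by rewrite s_gen inE.
  by elim: n => [|n IHn]; rewrite ?expg0 // expgS cs.
apply/shiftsP; exists (c 1); apply/permP=> -[u x].
by rewrite gc shiftE /= c1.
Qed.

(** Normalisers grow in p-groups: if a Sylow subgroup P contained [shifts] properly, so would the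
    normaliser of [shifts] in P. It is shown that this normaliser stays inside [shifts]. *)
Lemma shifts_Sylow : p.-Sylow(layered_aut s) shifts.
Proof.
have pT : p.-group shifts by rewrite /pgroup card_shifts pnat_id.
have [P sylP sTP] := Sylow_superset (shifts_layered_aut s) pT.
suff -> : shifts = P by [].
have pP := pHall_pgroup sylP; apply/eqP; rewrite -val_eqE /= eqEsubset sTP /=.
apply/idPn => nPT; have prT : shifts \proper P by rewrite properE sTP.
have := nilpotent_proper_norm (pgroup_nil pP) prT.
rewrite properE => /andP[_ /negP[]]; apply/subsetP=> g /setIP[Pg ng].
have [a ga] := norm_shifts ng.
(* Conjugation by g ^ n scales translations by a ^ n, so a ^ #|P| = 1; as #|P| is a power of p,
   Frobenius gives a ^ #|P| = a. *)
have a1 : a = 1%R.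
  have gX n : shift 1%R ^ (g ^+ n) = shift (a ^+ n)%R.
    elim: n => [|n IHn]; first by rewrite expg0 conjg1 expr0.
    by rewrite expgSr conjgM IHn ga exprS.
  have aX n : (a ^+ (p ^ n) = a)%R.
    elim: n => [|n IHn]; first by rewrite expn0 expr1.
    by rewrite expnSr exprM IHn -[in RHS](expf_card a) card_Fp.
  have [n on] := p_natP pP.
  have := gX #|P|; rewrite expg_cardG // conjg1 on aX.
  by move/permP/(_ (1, 0%R)); rewrite !shiftE /= !add0r => /(congr1 snd).
apply: (@layered_aut_shift g (fun u => (g (u, 0%R)).2)).
  exact: (subsetP (pHall_sub sylP)).
move=> u x; rewrite (norm_shiftsE ga) a1 mul1r.
by rewrite (pgroup_layer pP).
Qed.

End Generator.

(** * Isomorphic layered graphs have equal or inverse steps *)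

Hypothesis tiKL : K :&: L = 1.

Lemma layered_iso_norm s s' (f : {perm V}) : s ^+ 2 != 1 -> s' ^+ 2 != 1 ->
  f \in 'N(shifts) -> layered_iso s s' f -> s = s' \/ s = s'^-1.
Proof.
move=> s2 s'2 nf /layered_isoP isof; have [a fa] := norm_shifts nf.
have nz_a := norm_shifts_neq0 fa.
pose A : {unit 'F_p} := FinRing.unit 'F_p (etrans (unitfE a) nz_a).
have nz_Na : (- a != 0)%R by rewrite oppr_eq0.
pose N : {unit 'F_p} := FinRing.unit 'F_p (etrans (unitfE (- a)%R) nz_Na).
pose r u := (f (u, 0%R)).1.
(* The edges from layer u to layer s u go to edges along s' or against it. Going against it negates
   the differences, whence the multiplier [N] = -a in place of [A] = a. In both cases [block_affine]
   removes the additive constant, leaving a relation between cosets of [L]. *)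
have step u : r (s * u) = s' * r u /\ A * sgval u \in L :* sgval (r u) \/
    r u = s' * r (s * u) /\ N * sgval u \in L :* sgval (r (s * u)).
  have fu y := isof (u, 0%R) (s * u, y).
  have uu : val (sgval u) \in block (sgval u) by rewrite mem_block rcoset_refl.
  have : layered_adj s' (f (u, 0%R)) (f (s * u, val (sgval u))).
    by rewrite fu layered_adj_step // subr0.
  rewrite (norm_shiftsE fa _ (val _)) {1}/layered_adj /= -/(r u) -/(r (s * u)).
  case/orP=> /andP[/eqP e _]; [left | right]; split=> //.
    have H y : (a * y + ((f ((s * u)%g, 0%R)).2 - (f (u, 0%R)).2)
        \in block (sgval (r u)))%R = (y \in block (sgval u)).
      have := fu y; rewrite layered_adj_step // subr0 (norm_shiftsE fa _ y).
      rewrite [f (u, _)]surjective_pairing -/(r u) -/(r (s * u)) e.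
      by rewrite layered_adj_step // addrA.
    have := H (val (sgval u)); rewrite uu (block_affine nz_a H) addr0.
    by rewrite -mem_block.
  have H y : (- a * y + ((f (u, 0%R)).2 - (f ((s * u)%g, 0%R)).2)
      \in block (sgval (r (s * u)%g)))%R = (y \in block (sgval u)).
    have := fu y; rewrite layered_adj_step // subr0 (norm_shiftsE fa _ y).
    rewrite [f (u, _)]surjective_pairing -/(r u) -/(r (s * u)) e.
    rewrite layered_adj_sym layered_adj_step // => <-.
    by rewrite mulNr opprD [in LHS]addrCA addrA.
  have := H (val (sgval u)); rewrite uu (block_affine nz_Na H) addr0.
  by rewrite -mem_block.
(* Dividing the two memberships puts u v^-1 in [L], and it lies in [K] already. *)
have triv (u v : subg_of K) (B w : {unit 'F_p}) :
    B \in L :* w -> B * sgval u \in L :* (sgval v * w) -> u = v.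
  rewrite !mem_rcoset => LB LBu; apply: val_inj; apply/eqP.
  rewrite eq_mulgV1; apply/eqP/set1gP; rewrite -tiKL inE groupM ?groupV ?subgP //=.
  have cU (x y : {unit 'F_p}) : x * y = y * x.
    by apply: val_inj; rewrite /= mulrC.
  have <- : (B * w^-1)^-1 * (B * sgval u * (sgval v * w)^-1) = sgval u * (sgval v)^-1.
    by rewrite !invMg invgK -!mulgA mulKg mulgA (cU w) -mulgA mulKVg.
  by rewrite groupM ?groupV.
(* This rules out a change of direction between the two successive steps. *)
have nr : r (s * (s * 1)) != r 1.
  apply: contraNneq s2 => /(norm_shifts_layer fa).
  by rewrite mulg1 expg2 => /eqP.
case: (step 1) (step (s * 1)) => [] [e1 m1] [] [e2 m2].
- left; apply: (triv _ _ A (sgval (r 1))); first by rewrite mulg1 in m1.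
  by rewrite e1 mulg1 sgvalM in m2.
- by case/eqP: nr; apply: (mulgI s'); rewrite -e2 e1.
- by case/eqP: nr; rewrite e2 -e1.
- right; apply: (triv _ _ N (sgval (r (s * 1)))); first by rewrite mulg1 in m1.
  by rewrite -sgvalM ?inE // e2 mulKg -[s in sgval s]mulg1.
Qed.

(** The conjugate of [shifts] by f is a p-group of automorphisms of the target graph. By Sylow an
    automorphism g of that graph conjugates [shifts] to a group containing it, so f g^-1 is an
    isomorphism normalising [shifts]. *)
Lemma layered_iso_generator s s' (f : {perm V}) : <[s']> = [set: subg_of K] ->
  s ^+ 2 != 1 -> s' ^+ 2 != 1 -> layered_iso s s' f -> s = s' \/ s = s'^-1.
Proof.
move=> s'_gen s2 s'2 isof.
have sTf : shifts :^ f \subset layered_aut s'.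
  apply/subsetP=> _ /imsetP[t Tt ->].
  have := subsetP (shifts_layered_aut s) _ Tt.
  rewrite !inE => /layered_isoP ht; apply/layered_isoP.
  move/layered_isoP: isof => hf v w.
  rewrite -[v](permKV f) -[w](permKV f) -!permM -!conjgC !permM.
  by rewrite !hf ht.
have pTf : p.-group (shifts :^ f) by rewrite pgroupJ /pgroup card_shifts pnat_id.
have [g Ag sTg] := Sylow_subJ (shifts_Sylow s'_gen s'2) sTf pTf.
apply: (@layered_iso_norm s s' (f * g^-1)) => //.
  apply/normP; rewrite conjsgM; apply/eqP; rewrite eqEcard !cardJg leqnn andbT.
  by rewrite sub_conjgV.
have : g^-1 \in layered_aut s' by rewrite groupV.
rewrite inE => /layered_isoP hg; apply/layered_isoP=> v w.
by rewrite !permM hg; apply/layered_isoP.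
Qed.

End Layered.

Lemma affine_eqP p (a c : {unit 'F_p}) (b d : 'F_p) :
  affine a b = affine c d -> a = c /\ b = d.
Proof.
move=> e; have bd : b = d.
  by have /permP/(_ 0%R) := e; rewrite !permE /= !mul0r !add0r.
split=> //; apply: val_inj; apply: (addIr b).
by have /permP/(_ 1%R) := e; rewrite !permE /= !mul1r bd.
Qed.

Lemma orbit_conj_aut (gT : finGroupType) (G H : {group gT}) g :
  H \subset 'N(G) -> g \in G -> orbit 'P (conj_aut G @* H) g = g ^: H.
Proof.
move=> nGH Gg; apply/setP=> x; apply/imsetP/imsetP => -[h Hh ->].
  have [y nGy Hy ->] := morphimP Hh; exists y => //=.
  by rewrite /aperm norm_conj_autE.
exists (conj_aut G h); first by rewrite mem_morphim // (subsetP nGH).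
by rewrite /= /aperm norm_conj_autE // (subsetP nGH).
Qed.

(** * Identification of [Gamma_pq] with a layered graph *)

Section LayeredModel.

Variables (p q l : nat) (m : {unit 'F_p}).
Hypotheses (p_pr : prime p) (m_prim : generator [set: {unit 'F_p}] m).

Definition unit_subgroup n : {group {unit 'F_p}} := <[m ^+ (p.-1 %/ n)]>.

Local Notation K := (unit_subgroup q).
Local Notation L := (unit_subgroup l).
Local Notation V := (subg_of K * 'F_p)%type.

Lemma order_primitive : #[m] = p.-1.
Proof. by rewrite -card_units_Fp // (eqP m_prim). Qed.

Lemma order_unit_subgroup n : n %| p.-1 -> #[m ^+ (p.-1 %/ n)] = n.
Proof.
move=> n_dv; have p1_gt0 : (0 < p.-1)%N by rewrite -subn1 subn_gt0 prime_gt1.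
have k_gt0 : (0 < p.-1 %/ n)%N.
  by rewrite (divn_gt0 _ (dvdn_gt0 p1_gt0 n_dv)); apply: dvdn_leq.
rewrite orderXdiv order_primitive; last exact: dvdn_div.
by rewrite -[X in (X %/ _)%N](divnK n_dv); apply: mulKn.
Qed.

Lemma zmapX n : zmap m q ^+ n = mulmap ((m ^+ (p.-1 %/ q)) ^+ n).
Proof. by rewrite /zmap !mulmapX. Qed.

Lemma affine_Gpq u b : u \in K -> affine u b \in Gpq m q.
Proof.
case/cycleP=> n ->; set s := _ ^+ n.
have -> : affine s b = mulmap s * affine 1 b.
  by rewrite affineM mulg1 mul0r add0r.
by rewrite groupM // ?translE -?zmapX groupX // mem_gen // ?set21 ?set22.
Qed.

(** The affine maps with multiplier in [K] form a group containing both generators. The bound turns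
    injectivity of [layered_map] into bijectivity. *)
Lemma card_Gpq : (#|Gpq m q| <= #|{: V}|)%N.
Proof.
pose A := [set affine (sgval v.1) v.2 | v in {: V}].
have gA : group_set A.
  apply/group_setP; split=> [|_ _ /imsetP[[u b] _ ->] /imsetP[[v d] _ ->]].
    by apply/imsetP; exists (1, 0%R); rewrite //= affine1.
  apply/imsetP; exists (u * v, (b * val (sgval v) + d)%R) => //.
  by rewrite affineM.
apply: leq_trans (leq_imset_card (fun v : V => affine (sgval v.1) v.2) _).
apply: subset_leq_card; rewrite -/A -[A]/(gval (Group gA)) gen_subG.
apply/subsetP=> x /set2P[]->; apply/imsetP.
  exists (subg K (m ^+ (p.-1 %/ q)), 0%R); first by rewrite inE.
  by rewrite /zmap mulmapX /= subgK ?cycle_id.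
by exists (1, 1%R).
Qed.

Local Notation w := (m ^+ (p.-1 %/ l))%g.

Hypothesis w1 : w != 1.

(* The fixed point of the generator x |-> x w + 1 of Hl1 m l. *)
Definition fixpt : 'F_p := ((1 - val w)^-1)%R.

Lemma fixptE : (fixpt * (1 - val w) = 1)%R.
Proof.
rewrite mulVf // subr_eq0 eq_sym; apply: contra w1 => /eqP e.
by apply/eqP/val_inj.
Qed.

Lemma fixpt_neq0 : (fixpt != 0)%R.
Proof.
apply/eqP=> c0; have := fixptE.
by rewrite c0 mul0r => /eqP; rewrite eq_sym oner_eq0.
Qed.

(** Every power of the generator fixes [fixpt], which determines its constant term. *)
Lemma Hl1_powE n : (mulmap m ^+ (p.-1 %/ l) * transl p) ^+ n =
  affine (w ^+ n) (fixpt * (1 - val (w ^+ n)%g))%R.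
Proof.
elim: n => [|n IHn]; first by rewrite !expg0 FinRing.val_unit1 subrr mulr0 affine1.
rewrite [in LHS]expgSr IHn mulmapX !affineM mulg1 -expgSr; congr affine.
rewrite mul0r add0r -[X in (_ + X)%R]fixptE expgSr FinRing.val_unitM; ring.
Qed.

Lemma conj_mulmap (s a : {unit 'F_p}) (b : 'F_p) :
  mulmap s ^ affine a b = affine s (b * (1 - val s))%R.
Proof.
have cU (x y : {unit 'F_p}) : x * y = y * x by apply: val_inj; rewrite /= mulrC.
apply: (mulgI (affine a b)); rewrite -conjgC !affineM (cU s a); congr affine.
ring.
Qed.

Lemma class_HlP (s : {unit 'F_p}) g :
  reflect (exists2 h, h \in L & g = affine s (fixpt * (1 - val h) * (1 - val s))%R)
          (g \in mulmap s ^: Hl1 m l).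
Proof.
apply: (iffP imsetP) => [[x /cycleP[n ->] ->]|[h /cycleP[n ->] ->]].
  exists (w ^+ n); first exact: mem_cycle.
  by rewrite Hl1_powE conj_mulmap.
exists ((mulmap m ^+ (p.-1 %/ l) * transl p) ^+ n); first exact: mem_cycle.
by rewrite Hl1_powE conj_mulmap.
Qed.

(** For v = (u, x) this is the affine map with multiplier u that sends [fixpt] to [fixpt] (s - 1) x.
    With this scaling, left multiplication by the conjugate of [mulmap s] indexed by h in [L] adds
    exactly h u to x. *)
Definition layered_map (s : subg_of K) (v : V) : {perm 'F_p} :=
  affine (sgval v.1)
    (fixpt * ((val (sgval s) - 1) * v.2 - val (sgval v.1)))%R.

Lemma layered_map_class (s : subg_of K) (v w : V) : s != 1 ->
  (layered_map s w * (layered_map s v)^-1 \in mulmap (sgval s) ^: Hl1 m l) =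
  (w.1 == s * v.1) && (w.2 - v.2 \in block L (sgval v.1))%R.
Proof.
case: v w => [u x] [v y] s1 /=.
have nz : (fixpt * (val (sgval s) - 1) != 0)%R.
  rewrite mulf_neq0 ?fixpt_neq0 // subr_eq0; apply: contra s1 => /eqP e.
  by apply/eqP/val_inj/val_inj.
apply/class_HlP/andP => [[h Lh /(canRL (mulgKV _))]|[/eqP-> /imsetP[k]]].
  rewrite /layered_map affineM => /affine_eqP[/= e1 e2]; split.
    by apply/eqP/val_inj.
  apply/imsetP; exists (h * sgval u); first by rewrite mem_rcoset mulgK.
  apply: (mulfI nz); rewrite /= e1 /= in e2 *.
  apply/eqP; rewrite -subr_eq0; move/eqP: e2; rewrite -subr_eq0 => /eqP e2.
  apply/eqP; rewrite -[RHS]e2 /=; ring.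
rewrite mem_rcoset -{2}[k](mulgKV (sgval u)) => Lk /(canRL (subrK _)) e.
exists (k * (sgval u)^-1) => //; rewrite /= in e.
apply: (canLR (mulgK _)); rewrite /layered_map affineM; congr affine.
rewrite /= e /=; ring.
Qed.

(** The classes of z^n and of its inverse give the two orientations in [layered_adj]. *)
Lemma layered_map_adj (s : subg_of K) n (v w : V) : s != 1 ->
  sgval s = (m ^+ (p.-1 %/ q)) ^+ n ->
  @adj (Gamma_pq m q l n) (subg _ (layered_map s v)) (subg _ (layered_map s w))
    = layered_adj L s v w.
Proof.
move=> s1 sE; have Gs x : layered_map s x \in Gpq m q by apply/affine_Gpq/subgP.
have Gz : zmap m q ^+ n \in Gpq m q by rewrite groupX ?mem_gen ?set21.
rewrite /= !subgK // !orbit_conj_aut ?groupV ?Hl1_norm // inE /layered_adj.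
rewrite classVg inE invMg invgK zmapX -sE.
by rewrite !layered_map_class.
Qed.

Lemma layered_map_inj s : s != 1 -> injective (layered_map s).
Proof.
move=> s1 [u x] [v y] /affine_eqP[/= /val_inj <- e]; congr pair.
have nz : (val (sgval s) - 1 != 0)%R.
  rewrite subr_eq0; apply: contra s1 => /eqP es.
  by apply/eqP/val_inj/val_inj.
exact: (mulfI nz (addIr _ (mulfI fixpt_neq0 e))).
Qed.

Lemma layered_map_bij s : s != 1 ->
  bijective (fun v => subg (Gpq m q) (layered_map s v)).
Proof.
move=> s1; apply: inj_card_bij; last by rewrite card_sub card_Gpq.
move=> v w /(congr1 val); rewrite /= !subgK ?affine_Gpq ?subgP //.
exact: layered_map_inj.
Qed.

Lemma graph_iso_layered_iso s s' n n' : s != 1 -> s' != 1 ->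
  sgval s = (m ^+ (p.-1 %/ q)) ^+ n -> sgval s' = (m ^+ (p.-1 %/ q)) ^+ n' ->
  graph_iso (Gamma_pq m q l n) (Gamma_pq m q l n') ->
  exists f : {perm V}, layered_iso L s s' f.
Proof.
move=> s1 s'1 sE s'E [g bij_g adj_g].
have [k kK Kk] := layered_map_bij s'1.
pose f v := k (g (subg (Gpq m q) (layered_map s v))).
have inj_f : injective f.
  apply: inj_comp (can_inj Kk) (inj_comp (bij_inj bij_g) _).
  exact: bij_inj (layered_map_bij s1).
exists (perm inj_f); apply/layered_isoP => v w; rewrite !permE.
by rewrite -(layered_map_adj _ _ s'1 s'E) -(layered_map_adj _ _ s1 sE) !Kk adj_g.
Qed.

End LayeredModel.

(** * From steps back to indices *)

Lemma index_range_bounds q i : prime q -> index_range q i -> (0 < i < q)%N.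
Proof.
move=> /prime_gt1 q1; rewrite /index_range; case: eqP => [-> /eqP -> // | _].
case/andP=> -> /leq_ltn_trans -> //=.
by rewrite (leq_ltn_trans (leq_div _ _)) // subn1 ltn_predL ltnW.
Qed.

Theorem corollary4p2 (p q l i i' : nat) (m : {unit 'F_p})
    (p_prime : prime p) (q_prime : prime q) (q_dvd : (q %| p.-1)%N)
    (m_prim : generator [set: {unit 'F_p}] m)
    (l_gt1 : (1 < l)%N) (l_dvd : (l %| p.-1)%N) (q_ndvd_l : ~~ (q %| l)%N)
    (i_range : index_range q i) (i'_range : index_range q i') :
  graph_iso (Gamma_pq m q l i) (Gamma_pq m q l i') <-> i = i'.
Proof.
split=> [iso|<-]; last by exists id => //; exists id.
have /andP[i_gt0 i_ltq] := index_range_bounds q_prime i_range.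
have /andP[i'_gt0 i'_ltq] := index_range_bounds q_prime i'_range.
move: (i_range) (i'_range); rewrite /index_range.
(* For q = 2 every step squares to 1, so this case is settled directly by the index range. *)
have [q2|q_neq2] := eqVneq q 2; first by move=> /eqP-> /eqP->.
move=> /andP[_ i_le] /andP[_ i'_le].
set K := unit_subgroup m q; set L := unit_subgroup m l.
have oq : #[m ^+ (p.-1 %/ q)] = q by apply: order_unit_subgroup.
have ol : #[m ^+ (p.-1 %/ l)] = l by apply: order_unit_subgroup.
have w1 : m ^+ (p.-1 %/ l) != 1 by rewrite -order_eq1 ol neq_ltn l_gt1 orbT.
have ntL : L :!=: 1 by rewrite cycle_eq1.
have tiKL : K :&: L = 1.
  by apply: coprime_TIg; rewrite -!orderE oq ol prime_coprime.
pose s n : subg_of K := subg K ((m ^+ (p.-1 %/ q)) ^+ n).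
have sE n : sgval (s n) = (m ^+ (p.-1 %/ q)) ^+ n by rewrite subgK ?mem_cycle.
have s_neq1 n : (0 < n < q)%N -> s n != 1.
  case/andP=> n0 nq; apply/eqP=> /(congr1 val) /eqP; rewrite /= sE.
  by rewrite -order_dvdn oq gtnNdvd.
have cardK : #|[set: subg_of K]| = q by rewrite cardsT card_sub -orderE oq.
have os n : (0 < n < q)%N -> #[s n] = q.
  move=> /s_neq1; rewrite -order_eq1 => sn; apply/eqP.
  have /(primeP q_prime).2 : #[s n] %| q by rewrite -cardK order_dvdG ?inE.
  by rewrite (negPf sn).
have s_gen n : (0 < n < q)%N -> <[s n]> = [set: subg_of K].
  by move=> /os on; apply/eqP; rewrite eqEcard subsetT cardK -on /=.
have q_gt2 : (2 < q)%N by rewrite ltn_neqAle eq_sym q_neq2 prime_gt1.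
have s_sqr n : (0 < n < q)%N -> s n ^+ 2 != 1.
  by move=> /os on; rewrite -order_dvdn on gtnNdvd.
have iq : (0 < i < q)%N by rewrite i_gt0.
have i'q : (0 < i' < q)%N by rewrite i'_gt0.
have [f isof] := graph_iso_layered_iso w1
  (s_neq1 i iq) (s_neq1 i' i'q) (sE i) (sE i') iso.
have := layered_iso_generator p_prime ntL tiKL (s_gen i' i'q)
  (s_sqr i iq) (s_sqr i' i'q) isof.
case=> /(congr1 val); rewrite /= !sE => /eqP.
  by rewrite eq_expg_mod_order oq !modn_small // => /eqP.
(* Inverse steps would make q divide i' + i, but 0 < i' + i <= q - 1. *)
rewrite eq_sym eq_invg_mul -expgD -order_dvdn oq gtnNdvd //.
  by rewrite addn_gt0 i_gt0 orbT.
apply: leq_ltn_trans (leq_add i'_le i_le) _.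
by rewrite addnn -muln2 (leq_ltn_trans (leq_divM _ _)) // subn1 ltn_predL prime_gt0.
Qed.
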